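(* Let $V$ and $W$ be real operator systems. Then $(V\otimes_{\max}W)_c\cong V_c\otimes_{\max}W_c$ (canonically) as complex operator systems; that is, $V_c\otimes_{\max}W_c$ is the operator system complexification of $V\otimes_{\max}W$.
   Context: A real operator system is a unital selfadjoint real subspace of $B(H)$, $H$ a real Hilbert space, with matrix cones $M_n(V)^+$ (up to unital complete order isomorphism). The complexification of a real operator system $V$ is the complex operator system $V_c=V+iV$ with $(x+iy)^*=x^*-iy^*$, the same unit, and $M_n(V_c)^+=\{x+iy:x=x^*,\,y=-y^*\in M_n(V),\ \begin{bmatrix} x & -y \\ y & x \end{bmatrix}\in M_{2n}(V)^+\}$. As vector spaces $(V\otimes_{\mathbb{R}}W)_c=V_c\otimes_{\mathbb{C}}W_c$ canonically. For operator systems $V,W$ over $\mathbb{F}=\mathbb{R}$ or $\mathbb{C}$ with units $e,f$, the maximal tensor product $V\otimes_{\max}W$ is $V\otimes W$ with unit $e\otimes f$ and cones: a selfadjoint $x\in M_n(V\otimes W)$ is in $M_n(V\otimes_{\max}W)^+$ iff for every $\epsilon>0$ there exist finitely many $A_i\in M_{n_i}(V)^+$, $B_i\in M_{m_i}(W)^+$ ($i=1,\dots,k$) and a scalar matrix $\alpha$ over $\mathbb{F}$ of appropriate size with $x+\epsilon\,I_n\otimes e\otimes f=\alpha^*\,{\rm diag}(A_1\otimes B_1,\dots,A_k\otimes B_k)\,\alpha$. *)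

(* Defs.v *)
From HB Require Import structures.
From mathcomp Require Import all_boot all_order all_algebra.
From mathcomp Require Import generic_quotient sesquilinear.
From mathcomp Require Import boolp classical_sets reals topology normedtype.
From mathcomp Require Import complex mxtens.
Set Implicit Arguments.
Unset Strict Implicit.
Unset Printing Implicit Defensive.

Import Order.TTheory GRing.Theory Num.Theory numFieldNormedType.Exports.
Local Open Scope ring_scope.
Local Open Scope quotient_scope.

(* The scalars are a field F with a conjugation theta: (R, idfun) for real    *)
(* operator systems and (R[i], conjc) for complex ones.                       *)

Record mosystem (F : numFieldType) (theta : {rmorphism F -> F}) := MOSystem {
  carrier :> lmodType F;
  star : carrier -> carrier;
  starD : {morph star : x y / x + y};
  starZ : forall a x, star (a *: x) = theta a *: star x;
  starK : involutive star;
  mounit : carrier;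
  star_unit : star mounit = mounit;
  cone : forall n : nat, 'M[carrier]_n -> Prop
}.

Arguments mounit {F theta} m.

Section MatrixOrder.
Context {F : numFieldType} {theta : {rmorphism F -> F}}.

Definition mxstar (V : mosystem theta) n (X : 'M[V]_n) : 'M[V]_n :=
  map_mx (@star _ _ V) X^T.

(* alpha^* X alpha *)
Definition mxcompress (V : lmodType F) m n (alpha : 'M[F]_(m, n))
    (X : 'M[V]_m) : 'M[V]_n :=
  \matrix_(i, j) \sum_(k < m) \sum_(l < m) (theta (alpha k i) * alpha l j) *: X k l.

Record unital_complete_order_iso (V W : mosystem theta) (f : V -> W) : Prop := {
  uco_linear : linear f;
  uco_bij : bijective f;
  uco_unit : f (mounit V) = mounit W;
  uco_star : forall x, f (star x) = star (f x);
  uco_cone : forall n (X : 'M[V]_n), cone X <-> cone (map_mx f X)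
}.

End MatrixOrder.

Record hilbert (F : numFieldType) (theta : {rmorphism F -> F}) := Hilbert {
  hcarrier :> completeNormedModType F;
  inner : {dot hcarrier for theta};
  inner_norm : forall h : hcarrier, inner h h = `|h| ^+ 2
}.

Arguments inner {F theta} _.

(* phi identifies V, with its unit, involution and matrix cones, with a       *)
(* unital selfadjoint subspace of B(H); M_n(B(H)) acts on the column space    *)
(* H^n.  Over the reals the quadratic form does not control the selfadjoint   *)
(* part, so selfadjointness is part of positivity.                            *)
Record represents (F : numFieldType) (theta : {rmorphism F -> F})
    (V : mosystem theta) (H : hilbert theta) (phi : V -> {linear H -> H}) :
    Prop := {
  rep_bounded : forall v, continuous (phi v);
  rep_linear : forall a u v h, phi (a *: u + v) h = a *: phi u h + phi v h;
  rep_inj : forall u v, phi u =1 phi v -> u = v;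
  rep_unit : forall h, phi (mounit V) h = h;
  rep_star : forall v h k,
    inner H (phi v h) k = inner H h (phi (star v) k);
  rep_cone : forall n (X : 'M[V]_n),
    cone X <->
    mxstar X = X /\
    forall h : 'I_n -> H,
      0 <= \sum_(i < n) \sum_(j < n) inner H (phi (X i j) (h j)) (h i)
}.

Definition operator_system (F : numFieldType) (theta : {rmorphism F -> F})
    (V : mosystem theta) : Prop :=
  exists (H : hilbert theta) (phi : V -> {linear H -> H}), represents phi.

Section Tensor.
Context {F : fieldType}.
Variables V W : lmodType F.

(* A list of pairs stands for the sum of the corresponding pure tensors.      *)
Inductive tens_rel : seq (V * W) -> seq (V * W) -> Prop :=
| tens_refl s : tens_rel s s
| tens_sym s t : tens_rel s t -> tens_rel t s
| tens_trans s t u : tens_rel s t -> tens_rel t u -> tens_rel s u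
| tens_cat s s' t t' :
    tens_rel s s' -> tens_rel t t' -> tens_rel (s ++ t) (s' ++ t')
| tens_catC s t : tens_rel (s ++ t) (t ++ s)
| tens_0 w : tens_rel [:: (0, w)] [::]
| tens_Dl v v' w : tens_rel [:: (v + v', w)] [:: (v, w); (v', w)]
| tens_Dr v w w' : tens_rel [:: (v, w + w')] [:: (v, w); (v, w')]
| tens_Z a v w : tens_rel [:: (a *: v, w)] [:: (v, a *: w)].

Definition tens_eqb : rel (seq (V * W)) := fun s t => `[< tens_rel s t >].

Lemma tens_eqb_equiv : equiv_class_of tens_eqb.
Proof.
split=> [s|s t|t s u].
- exact/asboolP/tens_refl.
- by apply/asboolP/asboolP => /tens_sym.
- by move=> /asboolP st /asboolP tu; exact/asboolP/(tens_trans st tu).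
Qed.

Canonical tens_equiv := EquivRelPack tens_eqb_equiv.

Definition tensor : Type := {eq_quot tens_equiv}.
HB.instance Definition _ : EqQuotient _ tens_equiv tensor :=
  EqQuotient.on tensor.
HB.instance Definition _ := Choice.on tensor.

Definition pure (v : V) (w : W) : tensor := \pi_tensor [:: (v, w)].

Lemma tens_piP s t : \pi_tensor s = \pi_tensor t <-> tens_rel s t.
Proof.
split=> [/eqmodP/asboolP //|st]; exact/eqmodP/asboolP.
Qed.

Lemma tens_reprP s : tens_rel (repr (\pi_tensor s)) s.
Proof. by apply/tens_piP; rewrite reprK. Qed.

Definition oppp (p : V * W) := (- p.1, p.2).

Lemma tens_map_oppr s t :
  tens_rel s t -> tens_rel (map oppp s) (map oppp t).
Proof.
elim=> {s t} //=.
- by move=> s; exact: tens_refl.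
- by move=> s t _; exact: tens_sym.
- by move=> s t u _ + _; exact: tens_trans.
- by move=> s s' t t' _ ? _ ?; rewrite !map_cat; exact: tens_cat.
- by move=> s t; rewrite !map_cat; exact: tens_catC.
- by move=> w; rewrite /oppp /= oppr0; exact: tens_0.
- by move=> v v' w; rewrite /oppp /= opprD; exact: tens_Dl.
- by move=> v w w'; exact: tens_Dr.
- by move=> a v w; rewrite /oppp /= -scalerN; exact: tens_Z.
Qed.

Definition tzero : tensor := \pi_tensor [::].
Definition tadd (x y : tensor) : tensor := \pi_tensor (repr x ++ repr y).
Definition topp (x : tensor) : tensor := \pi_tensor (map oppp (repr x)).

Let taddE s t : tadd (\pi_tensor s) (\pi_tensor t) = \pi_tensor (s ++ t).
Proof. by apply/tens_piP; apply: tens_cat; apply: tens_reprP. Qed.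

Let taddA : associative tadd.
Proof.
elim/quotW=> s; elim/quotW=> t; elim/quotW=> u.
by rewrite (taddE t u) (taddE s t) !taddE catA.
Qed.

Let taddC : commutative tadd.
Proof. by move=> x y; apply/tens_piP; exact: tens_catC. Qed.

Let tadd0 : left_id tzero tadd.
Proof. by by elim/quotW=> s; rewrite taddE. Qed.

Let taddN : left_inverse tzero topp tadd.
Proof.
move=> x; rewrite -[X in tadd _ X]reprK taddE; apply/tens_piP.
elim: (repr x) => [|[v w] s IHs] /=; first exact: tens_refl.
apply: (@tens_trans _ ([:: (- v, w); (v, w)] ++ (map oppp s ++ s))).
  rewrite -cat1s -[X in tens_rel _ X]/([:: oppp (v, w)] ++ ([:: (v, w)] ++ _)).
  apply: tens_cat; first exact: tens_refl.
  rewrite -[(v, w) :: s]cat1s !catA; apply: tens_cat (tens_refl _).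
  exact: tens_catC.
rewrite -[X in tens_rel _ X]cat0s; apply: tens_cat IHs.
apply: tens_trans (tens_sym (tens_Dl _ _ _)) _.
by rewrite addNr; exact: tens_0.
Qed.

HB.instance Definition _ :=
  GRing.isZmodule.Build tensor taddA taddC tadd0 taddN.

Lemma pi_cat s t :
  \pi_tensor (s ++ t) = \pi_tensor s + \pi_tensor t :> tensor.
Proof. by rewrite -taddE. Qed.

Lemma pi_nil : \pi_tensor [::] = 0 :> tensor. Proof. by []. Qed.

Lemma pi_sum s : \pi_tensor s = \sum_(p <- s) pure p.1 p.2.
Proof.
elim: s => [|[v w] s IHs]; first by rewrite big_nil.
by rewrite big_cons -IHs -cat1s pi_cat.
Qed.

Lemma pureDl v v' w : pure (v + v') w = pure v w + pure v' w.
Proof. by rewrite -pi_cat; apply/tens_piP; exact: tens_Dl. Qed.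

Lemma pureDr v w w' : pure v (w + w') = pure v w + pure v w'.
Proof. by rewrite -pi_cat; apply/tens_piP; exact: tens_Dr. Qed.

Lemma pure_balanced a v w : pure (a *: v) w = pure v (a *: w).
Proof. by apply/tens_piP; exact: tens_Z. Qed.

Lemma tensor_sum (x : tensor) : x = \sum_(p <- repr x) pure p.1 p.2.
Proof. by rewrite -pi_sum reprK. Qed.

Section Lift.
Variables (A : zmodType) (b : V -> W -> A).

Definition tlift (x : tensor) : A := \sum_(p <- repr x) b p.1 p.2.

Hypothesis bDl : forall v v' w, b (v + v') w = b v w + b v' w.
Hypothesis bDr : forall v w w', b v (w + w') = b v w + b v w'.
Hypothesis bZ : forall a v w, b (a *: v) w = b v (a *: w).

Lemma tlift_pi s : tlift (\pi_tensor s) = \sum_(p <- s) b p.1 p.2.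
Proof.
suff eqS t u : tens_rel t u ->
    \sum_(p <- t) b p.1 p.2 = \sum_(p <- u) b p.1 p.2.
  exact/eqS/tens_reprP.
elim=> {t u} //.
- by move=> t u v _ -> _ ->.
- by move=> t t' u u' _ e _ e'; rewrite !big_cat /= e e'.
- by move=> t u; rewrite !big_cat /= addrC.
- move=> w; rewrite big_seq1 big_nil /=.
  by apply: (addrI (b 0 w)); rewrite -bDl !addr0.
- by move=> v v' w; rewrite !big_cons !big_nil /= bDl !addr0.
- by move=> v w w'; rewrite !big_cons !big_nil /= bDr !addr0.
- by move=> a v w; rewrite !big_seq1 /= bZ.
Qed.

Lemma tlift_pure v w : tlift (pure v w) = b v w.
Proof. by rewrite tlift_pi big_seq1. Qed.

Lemma tliftD : {morph tlift : x y / x + y}.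
Proof.
move=> x y; rewrite -[x]reprK -[y]reprK -pi_cat !tlift_pi.
by rewrite big_cat.
Qed.

End Lift.

Lemma tensor_ind (P : tensor -> Prop) :
  P 0 -> (forall v w, P (pure v w)) -> (forall x y, P x -> P y -> P (x + y)) ->
  forall x, P x.
Proof.
move=> P0 Pp PD x; rewrite [x]tensor_sum.
by elim/big_ind: _ => // p _; exact: Pp.
Qed.

Lemma tlift_unique (A : zmodType) (f g : tensor -> A) :
  {morph f : x y / x + y} -> {morph g : x y / x + y} ->
  (forall v w, f (pure v w) = g (pure v w)) -> f =1 g.
Proof.
move=> fD gD fg; apply: tensor_ind => //; last first.
  by move=> x y fx fy; rewrite fD gD fx fy.
have -> : f 0 = 0 by apply: (addrI (f 0)); rewrite -fD !addr0.
by apply: (addrI (g 0)); rewrite -gD !addr0.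
Qed.

Definition tscale (a : F) : tensor -> tensor := tlift (fun v w => pure (a *: v) w).

Let tscale_pure a v w : tscale a (pure v w) = pure (a *: v) w.
Proof.
rewrite /tscale tlift_pure // => [v1 v2 u|v1 u1 u2|c v1 u].
- by rewrite scalerDr pureDl.
- exact: pureDr.
- by rewrite -pure_balanced !scalerA mulrC.
Qed.

Let tscaleDr a : {morph tscale a : x y / x + y}.
Proof.
apply: tliftD => [v1 v2 u|v1 u1 u2|c v1 u].
- by rewrite scalerDr pureDl.
- exact: pureDr.
- by rewrite -pure_balanced !scalerA mulrC.
Qed.

Let tscaleA a c x : tscale a (tscale c x) = tscale (a * c) x.
Proof.
apply: (@tlift_unique _ (fun x => tscale a (tscale c x))) => [y z|y z|v w] /=.
- by rewrite !tscaleDr.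
- by rewrite tscaleDr.
- by rewrite !tscale_pure scalerA.
Qed.

Let tscale1 x : tscale 1 x = x.
Proof.
apply: (@tlift_unique _ (tscale 1) id) => // v w.
by rewrite tscale_pure scale1r.
Qed.

Let tscaleDl x : {morph tscale^~ x : a c / a + c}.
Proof.
move=> a c; apply: (@tlift_unique _ (tscale (a + c))
  (fun x => tscale a x + tscale c x)) => [y z|y z|v w] /=.
- by rewrite tscaleDr.
- by rewrite !tscaleDr addrACA.
- by rewrite !tscale_pure scalerDl pureDl.
Qed.

HB.instance Definition _ :=
  GRing.Zmodule_isLmodule.Build F tensor tscaleA tscale1 tscaleDr tscaleDl.

Lemma pureZl a v w : pure (a *: v) w = a *: pure v w.
Proof. exact: esym (tscale_pure a v w). Qed.

Lemma pureZr a v w : pure v (a *: w) = a *: pure v w.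
Proof. by rewrite -pure_balanced pureZl. Qed.

Lemma tensor_universal (X : lmodType F) (b : V -> W -> X) :
  (forall w, linear (b^~ w)) -> (forall v, linear (b v)) ->
  exists! f : tensor -> X, linear f /\ forall v w, f (pure v w) = b v w.
Proof.
move=> bl br.
have bDl v v' w : b (v + v') w = b v w + b v' w.
  by have := bl w 1 v v'; rewrite !scale1r.
have bDr v w w' : b v (w + w') = b v w + b v w'.
  by have := br v 1 w w'; rewrite !scale1r.
have bv0 v : b v 0 = 0 by apply: (addrI (b v 0)); rewrite -bDr !addr0.
have b0v w : b 0 w = 0 by apply: (addrI (b 0 w)); rewrite -bDl !addr0.
have bZl a v w : b (a *: v) w = a *: b v w.
  by have := bl w a v 0; rewrite !addr0 b0v addr0.
have bZr a v w : b v (a *: w) = a *: b v w.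
  by have := br v a w 0; rewrite !addr0 bv0 addr0.
have bZ a v w : b (a *: v) w = b v (a *: w) by rewrite bZl bZr.
exists (tlift b); split; first split; last 2 first.
- exact: tlift_pure.
- move=> g [gl gp]; apply/funext/tlift_unique => [|x y|v w].
  + exact: tliftD.
  + by have := gl 1 x y; rewrite !scale1r.
  + by rewrite tlift_pure.
move=> a x y; rewrite tliftD //; congr (_ + _).
apply: (@tlift_unique _ (fun x => tlift b (a *: x)) (fun x => a *: tlift b x)).
- by move=> u v; rewrite scalerDr tliftD.
- by move=> u v; rewrite tliftD // scalerDr.
- by move=> v w; rewrite -pureZl !tlift_pure.
Qed.

End Tensor.

Section MaxTensor.
Context {F : numFieldType} {theta : {rmorphism F -> F}}.
Variables V W : mosystem theta.

(* The involution of V (x) W determined by (v (x) w)^* = v^* (x) w^*.         *)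
Definition tstar : tensor V W -> tensor V W :=
  tlift (fun v w => pure (star v) (star w)).

Let sDl (v v' : V) (w : W) :
  pure (star (v + v')) (star w) =
  pure (star v) (star w) + pure (star v') (star w).
Proof. by rewrite starD pureDl. Qed.

Let sDr (v : V) (w w' : W) :
  pure (star v) (star (w + w')) =
  pure (star v) (star w) + pure (star v) (star w').
Proof. by rewrite starD pureDr. Qed.

Let sZ a (v : V) (w : W) :
  pure (star (a *: v)) (star w) = pure (star v) (star (a *: w)).
Proof. by rewrite !starZ pure_balanced. Qed.

Lemma tstar_pure (v : V) (w : W) : tstar (pure v w) = pure (star v) (star w).
Proof. exact: tlift_pure. Qed.

Lemma tstarD : {morph tstar : x y / x + y}.
Proof. exact: tliftD. Qed.

Lemma tstarZ a x : tstar (a *: x) = theta a *: tstar x.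
Proof.
apply: (@tlift_unique _ _ _ _ (fun x => tstar (a *: x))
  (fun x => theta a *: tstar x)) => [u v|u v|v w].
- by rewrite scalerDr tstarD.
- by rewrite tstarD scalerDr.
- by rewrite -pureZl !tstar_pure starZ pureZl.
Qed.

Lemma tstarK : involutive tstar.
Proof.
apply: (@tlift_unique _ _ _ _ (fun x => tstar (tstar x)) id) => // [u v|v w].
- by rewrite !tstarD.
- by rewrite !tstar_pure !starK.
Qed.

Lemma tstar_unit :
  tstar (pure (mounit V) (mounit W)) = pure (mounit V) (mounit W).
Proof. by rewrite tstar_pure !star_unit. Qed.

Definition kron p q (A : 'M[V]_p) (B : 'M[W]_q) : 'M[tensor V W]_(p * q) :=
  \matrix_(i, j) pure (A (mxtens_unindex i).1 (mxtens_unindex j).1)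
                      (B (mxtens_unindex i).2 (mxtens_unindex j).2).

Definition max_cone n (X : 'M[tensor V W]_n) : Prop :=
  map_mx tstar X^T = X /\
  forall eps : F, 0 < eps ->
    exists (k : nat) (p q : 'I_k -> nat)
      (A : forall i, 'M[V]_(p i)) (B : forall i, 'M[W]_(q i))
      (alpha : 'M[F]_(\sum_(i < k) p i * q i, n)),
    [/\ forall i, cone (A i), forall i, cone (B i)
      & X + (eps *: pure (mounit V) (mounit W))%:M
        = mxcompress (theta := theta) alpha (\mxdiag_(i < k) kron (A i) (B i))].

Definition max_tensor : mosystem theta :=
  MOSystem tstarD tstarZ tstarK tstar_unit max_cone.

End MaxTensor.

Section Complexification.
Variable R : realType.
Local Notation C := R[i].

(* (x, y) stands for x + i y *)
Definition complexify (V : lmodType R) : Type := (V * V)%type.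

Section Lmodule.
Variable V : lmodType R.

HB.instance Definition _ := GRing.Zmodule.on (complexify V).

Let cscale (z : C) (x : complexify V) : complexify V :=
  let: (a +i* b)%C := z in (a *: x.1 - b *: x.2, a *: x.2 + b *: x.1).

Let cscaleA z w x : cscale z (cscale w x) = cscale (z * w) x.
Proof.
case: z w => [a b] [c d]; case: x => [x y]; rewrite /cscale /=.
by congr (_, _); rewrite ?scalerDr ?scalerDl ?scalerN ?scaleNr !scalerA ?opprD;
  rewrite [X in _ + X = _]addrC addrACA.
Qed.

Let cscale1 x : cscale 1 x = x.
Proof. by case: x => x y; rewrite /cscale /= !scale1r !scale0r subr0 addr0. Qed.

Let cscaleDr : right_distributive cscale +%R.
Proof.
case=> a b [x y] [x' y']; rewrite /cscale /=; congr (_, _) => /=.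
  by rewrite !scalerDr opprD addrACA.
by rewrite !scalerDr addrACA.
Qed.

Let cscaleDl x : {morph cscale^~ x : z w / z + w}.
Proof.
case: x => x y [a b] [c d]; rewrite /cscale /=; congr (_, _) => /=.
  by rewrite !scalerDl opprD addrACA.
by rewrite !scalerDl addrACA.
Qed.

HB.instance Definition _ := GRing.Zmodule_isLmodule.Build C (complexify V)
  cscaleA cscale1 cscaleDr cscaleDl.

Lemma complexifyZ (a b : R) (x y : V) :
  (a +i* b)%C *: ((x, y) : complexify V)
  = (a *: x - b *: y, a *: y + b *: x).
Proof. by []. Qed.

Definition cembed (x : V) : complexify V := (x, 0).

End Lmodule.

Variable V : mosystem (idfun : {rmorphism R -> R}).

Definition cstar (x : complexify V) : complexify V := (star x.1, - star x.2).

Let starN (x : V) : star (- x) = - star x.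
Proof. by rewrite -scaleN1r starZ rmorphN1 scaleN1r. Qed.

Lemma cstarD : {morph cstar : x y / x + y}.
Proof.
by move=> x y; rewrite /cstar /= !starD opprD.
Qed.

Lemma cstarZ (z : C) x : cstar (z *: x) = conjc z *: cstar x.
Proof.
case: z x => [a b] [x y]; rewrite /cstar !complexifyZ /=.
by congr (_, _);
  rewrite starD ?starN !starZ /= ?scalerN ?scaleNr ?opprK ?opprD.
Qed.

Lemma cstarK : involutive cstar.
Proof. by case=> x y; rewrite /cstar /= starN opprK !starK. Qed.

Lemma cstar_unit : cstar (cembed (mounit V)) = cembed (mounit V).
Proof.
rewrite /cstar /cembed /= star_unit.
by rewrite -{1}(scale0r (0 : V)) starZ /= scale0r oppr0.
Qed.

Definition ccone n (Z : 'M[complexify V]_n) : Prop :=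
  let x := map_mx fst Z : 'M[V]_n in
  let y := map_mx snd Z : 'M[V]_n in
  [/\ x = mxstar x, y = - mxstar y & cone (block_mx x (- y) y x)].

Definition complexification : mosystem (conjc : {rmorphism C -> C}) :=
  MOSystem cstarD cstarZ cstarK cstar_unit ccone.

End Complexification.

(* Main.v *)
Require Import Defs.
From mathcomp Require Import all_boot all_order all_algebra.
From mathcomp Require Import normedtype sesquilinear ssrAC.
From mathcomp Require Import reals complex mxtens.
Set Implicit Arguments.
Unset Strict Implicit.
Unset Printing Implicit Defensive.
Import Order.TTheory GRing.Theory Num.Theory.
Local Open Scope ring_scope.

(* Under the identification of V_c (x) W_c with (V (x) W)_c, the passage from *)
(* x + iy to the real matrix [x -y; y x] turns scalar compressions into       *)
(* scalar compressions and is inverted by compressing with (1; -i)/sqrt 2.    *)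
(* It sends A (x) B to a compression of [a -a'; a' a] (x) [b -b'; b' b]: with *)
(* J the rotation by a right angle, the latter acts on R^2 (x) R^2, and the   *)
(* plane where J (x) 1 = 1 (x) J is a copy of C.  So a decomposition of       *)
(* x + eps in either maximal cone transports, with the same eps, to the other.*)

(** For Z = x + iy with entries in (V (x) W)_c, let c(Z) = [x -y; y x], the matrix [cblock Z].
    Positivity of Z in the complexification means that Z is selfadjoint and c(Z) lies in the real
    maximal cone; positivity of [canon Z] asks for complex decompositions of [canon Z] + eps.
    Algebraically [canon] is a star-preserving isomorphism whose inverse [uncanon] multiplies out (v
    + iv') (x) (w + iw'). What remains is to compare real and complex decompositions into sums of
    alpha^* (A (x) B) alpha, the predicate [max_sum].

    From real to complex ([max_sum_canon]), read a decomposition of c(Z) over C. Each A stays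
    positive because [A 0; 0 A] is positive ([cone_cembed]), and compressing by (1; -i)/sqrt 2 turns
    c(Z) back into Z ([canon_fold_mx]).

    From complex to real ([max_sum_cblock]), apply c to every summand: c(alpha^* Z alpha) is the
    compression of c(Z) by c(alpha) ([cblock_compress]), and c(A (x) B) is a compression of c(A) (x)
    c(B) ([cblock_kron]), whose factors are positive by the definition of the cones of V_c and W_c.

    Both passages preserve eps times the unit, so they apply to each eps separately. *)

Section Compression.
Context {F : numFieldType} {theta : {rmorphism F -> F}}.
Implicit Type V : lmodType F.

Lemma mxcompress_comp V m n p (alpha : 'M[F]_(m, n)) (beta : 'M[F]_(n, p))
    (X : 'M[V]_m) :
  mxcompress (theta := theta) beta (mxcompress (theta := theta) alpha X)
  = mxcompress (theta := theta) (alpha *m beta) X.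
Proof.
apply/matrixP => i j; rewrite !mxE.
transitivity (\sum_k \sum_l \sum_a \sum_b
    (theta (beta k i) * beta l j * (theta (alpha a k) * alpha b l)) *: X a b).
  apply: eq_bigr => k _; apply: eq_bigr => l _; rewrite mxE scaler_sumr.
  apply: eq_bigr => a _; rewrite scaler_sumr.
  by apply: eq_bigr => b _; rewrite scalerA.
under eq_bigr do rewrite exchange_big /=.
rewrite exchange_big; apply: eq_bigr => a _ /=.
under eq_bigr do rewrite exchange_big /=.
rewrite exchange_big; apply: eq_bigr => b _ /=.
rewrite !mxE rmorph_sum mulr_suml scaler_suml; apply: eq_bigr => k _.
rewrite mulr_sumr scaler_suml; apply: eq_bigr => l _.
by rewrite rmorphM mulrACA [beta l j * _]mulrC [theta (beta k i) * _]mulrC.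
Qed.

Lemma mxcompress_diag V k (p : 'I_k -> nat) n
    (alpha : 'M[F]_(\sum_i p i, n)) (B : forall i, 'M[V]_(p i)) :
  mxcompress (theta := theta) alpha (\mxdiag_i B i)
  = \sum_i mxcompress (theta := theta) (submxcol alpha i) (B i).
Proof.
apply/matrixP => s t; rewrite mxE summxE.
under [RHS]eq_bigr do rewrite mxE.
rewrite [RHS]sig_big_dep /= (reindex _ tagnat.sig_bij_on) /=.
apply: eq_bigr => a _.
transitivity (\sum_i \sum_(l < p i) (theta (alpha a s) *
   alpha (tagnat.Rank i l) t) *: (\mxdiag_i B i) a (tagnat.Rank i l)).
  rewrite [RHS]sig_big_dep /= (reindex _ tagnat.sig_bij_on) /=.
  by apply: eq_bigr => b _; rewrite tagnat.sig2K.
(* In row a only the block containing a is nonzero. *)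
rewrite (bigD1 (tagnat.sig1 a)) //= [X in _ + X]big1 ?addr0 => [|i ia].
  apply: eq_bigr => l _; rewrite !mxE tagnat.sig2K.
  congr (_ *: _).
  have := congr1 (fun M => fun_of_matrix M (tagnat.sig2 a) l)
    (submxblock_diag B (tagnat.sig1 a)).
  by rewrite /= => <-; rewrite !mxE tagnat.sig2K.
apply: big1 => l _; rewrite mxE; case: eqVneq => [e|_].
  by rewrite e tagnat.Rank1K eqxx in ia.
by rewrite mxE scaler0.
Qed.

(** Both [twist] and [fold_mx] have columns supported on at most two rows; this evaluates their
    compressions entrywise. *)
Lemma mxcompress_pair V m n (f g : 'I_n -> 'I_m) (b c : 'I_n -> F)
    (X : 'M[V]_m) :
  mxcompress (theta := theta)
    (\matrix_(k, i) (b i *+ (k == f i) + c i *+ (k == g i))) X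
  = \matrix_(i, j)
      ((theta (b i) * b j) *: X (f i) (f j)
       + (theta (b i) * c j) *: X (f i) (g j)
       + ((theta (c i) * b j) *: X (g i) (f j)
       + (theta (c i) * c j) *: X (g i) (g j))).
Proof.
have sum_delta (h : 'I_m) (G : 'I_m -> V) : \sum_k G k *+ (k == h) = G h.
  rewrite (bigD1 h) //= eqxx big1 ?addr0 // => k /negPf kh.
  by rewrite kh mulr0n.
apply/matrixP => i j; rewrite !mxE.
transitivity (\sum_k
   ((theta (b i)) *: (b j *: X k (f j) + c j *: X k (g j)) *+ (k == f i)
   + (theta (c i)) *: (b j *: X k (f j) + c j *: X k (g j)) *+ (k == g i))).
  apply: eq_bigr => k _.
  transitivity (theta (b i *+ (k == f i) + c i *+ (k == g i)) *:
     \sum_l (b j *: X k l *+ (l == f j) + c j *: X k l *+ (l == g j))).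
    rewrite scaler_sumr; apply: eq_bigr => l _.
    by rewrite !mxE -scalerA scalerDl -!scalerMnl.
  rewrite big_split /= (sum_delta _ (fun l => b j *: X k l)).
  rewrite (sum_delta _ (fun l => c j *: X k l)).
  by rewrite rmorphD !rmorphMn scalerDl -!scalerMnl.
rewrite big_split /= !sum_delta.
by rewrite !scalerDr !scalerA.
Qed.

Lemma mxcompress_sum V m n (alpha : 'M[F]_(m, n)) I (r : seq I) (P : pred I)
    (G : I -> 'M[V]_m) :
  mxcompress (theta := theta) alpha (\sum_(i <- r | P i) G i)
  = \sum_(i <- r | P i) mxcompress (theta := theta) alpha (G i).
Proof.
apply: (big_morph (mxcompress alpha)) => [X Y|]; apply/matrixP => i j.
  rewrite !mxE -big_split; apply: eq_bigr => k _ /=.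
  by rewrite -big_split; apply: eq_bigr => l _; rewrite mxE scalerDr.
by rewrite !mxE big1 // => k _; rewrite big1 // => l _; rewrite mxE scaler0.
Qed.

End Compression.

Lemma star0 (F : numFieldType) (theta : {rmorphism F -> F})
    (V : mosystem theta) : star (0 : V) = 0.
Proof. by rewrite -[X in star X](scale0r 0) starZ rmorph0 scale0r. Qed.

(** * Decompositions as finite sums of compressions *)

Section MaxConeSum.
Context {F : numFieldType} {theta : {rmorphism F -> F}}.
Variables V W : mosystem theta.

(** The decomposability condition of [max_cone] for one fixed eps, with [alpha] cut into its block
    rows so that linear maps can be applied summand by summand. *)
Definition max_sum n (X : 'M[tensor V W]_n) : Prop :=
  exists (k : nat) (p q : 'I_k -> nat)
    (A : forall i, 'M[V]_(p i)) (B : forall i, 'M[W]_(q i))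
    (alpha : forall i, 'M[F]_(p i * q i, n)),
  [/\ forall i, cone (A i), forall i, cone (B i)
    & X = \sum_i mxcompress (theta := theta) (alpha i) (kron (A i) (B i))].

Lemma max_coneP n (X : 'M[tensor V W]_n) :
  max_cone X <-> map_mx (@tstar _ _ V W) X^T = X /\
   forall eps : F, 0 < eps ->
     max_sum (X + (eps *: pure (mounit V) (mounit W))%:M).
Proof.
split=> -[Xs Xp]; split=> // eps /Xp.
  move=> [k [p [q [A [B [alpha [cA cB E]]]]]]].
  exists k, p, q, A, B, (submxcol alpha); split=> //.
  by rewrite E mxcompress_diag.
move=> [k [p [q [A [B [alpha [cA cB E]]]]]]].
exists k, p, q, A, B, (\mxcol_i alpha i); split=> //.
by rewrite E mxcompress_diag; apply: eq_bigr => i _; rewrite mxcolK.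
Qed.

End MaxConeSum.

(** * The real form [x -y; y x] and its compatibility with compressions *)

Section RealForm.
Variable R : realType.
Local Notation C := R[i].

Definition cblock (V : lmodType R) n (Z : 'M[complexify V]_n) : 'M[V]_(n + n) :=
  block_mx (map_mx fst Z) (- map_mx snd Z) (map_mx snd Z) (map_mx fst Z).

Definition rblock m n (alpha : 'M[C]_(m, n)) : 'M[R]_(m + m, n + n) :=
  block_mx (map_mx (@complex.Re R) alpha) (- map_mx (@complex.Im R) alpha)
    (map_mx (@complex.Im R) alpha) (map_mx (@complex.Re R) alpha).

Lemma cblockE (V : lmodType R) n (Z : 'M[complexify V]_n) i j :
  (cblock Z (lshift n i) (lshift n j) = (Z i j).1)
  * (cblock Z (lshift n i) (rshift n j) = - (Z i j).2)
  * (cblock Z (rshift n i) (lshift n j) = (Z i j).2)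
  * (cblock Z (rshift n i) (rshift n j) = (Z i j).1).
Proof.
by rewrite /cblock block_mxEul block_mxEur block_mxEdl block_mxEdr !mxE.
Qed.

Lemma fst_sum (V : lmodType R) I (r : seq I) (P : pred I)
    (G : I -> complexify V) :
  fst (\sum_(i <- r | P i) G i) = \sum_(i <- r | P i) fst (G i).
Proof. exact: (big_morph fst). Qed.

Lemma snd_sum (V : lmodType R) I (r : seq I) (P : pred I)
    (G : I -> complexify V) :
  snd (\sum_(i <- r | P i) G i) = \sum_(i <- r | P i) snd (G i).
Proof. exact: (big_morph snd). Qed.

Lemma cblockD (V : lmodType R) n : {morph @cblock V n : X Y / X + Y}.
Proof.
by move=> X Y; rewrite /cblock add_block_mx !map_mxD opprD.
Qed.

Lemma cblock0 (V : lmodType R) n : @cblock V n 0 = 0.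
Proof. by apply: (addrI (cblock 0)); rewrite -cblockD !addr0. Qed.

Lemma cblock_sum (V : lmodType R) n I (r : seq I) (P : pred I)
    (G : I -> 'M[complexify V]_n) :
  cblock (\sum_(i <- r | P i) G i) = \sum_(i <- r | P i) cblock (G i).
Proof. exact: (big_morph _ (@cblockD V n) (@cblock0 V n)). Qed.

(** Passing to real forms is multiplicative and turns the conjugate transpose of [alpha] into the
    transpose of [rblock alpha]. *)
Lemma cblock_compress (V : lmodType R) m n (alpha : 'M[C]_(m, n))
    (Z : 'M[complexify V]_m) :
  cblock (mxcompress (theta := conjc) alpha Z)
  = mxcompress (theta := idfun) (rblock alpha) (cblock Z).
Proof.
have sum2 (G : 'I_(m + m) -> V) :
    \sum_k G k = \sum_k (G (lshift m k) + G (rshift m k)).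
  by rewrite big_split_ord big_split.
have split4 (G : 'I_(m + m) -> 'I_(m + m) -> V) :
    \sum_k \sum_l G k l = \sum_k \sum_l
      (G (lshift m k) (lshift m l) + G (lshift m k) (rshift m l)
      + (G (rshift m k) (lshift m l) + G (rshift m k) (rshift m l))).
  by rewrite sum2; apply: eq_bigr => k _; rewrite !sum2 -big_split.
apply/matrixP => i j; rewrite [RHS]mxE split4.
case: (split_ordP i) => i' ->; case: (split_ordP j) => j' ->;
  rewrite !(block_mxEul, block_mxEur, block_mxEdl, block_mxEdr) !mxE;
  rewrite ?(fst_sum, snd_sum) -?sumrN; apply: eq_bigr => k _;
  rewrite ?(fst_sum, snd_sum) -?sumrN; apply: eq_bigr => l _;
  rewrite !(block_mxEul, block_mxEur, block_mxEdl, block_mxEdr) !mxE;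
  case: (alpha k i') => a b; case: (alpha l j') => c d; case: (Z k l) => x y /=;
  rewrite ?(mulrN, mulNr, opprK, scalerN, scaleNr, scalerDl, opprD, scalerBl).
- by rewrite [LHS](AC (2*2) ((1*3)*(4*2))).
- by rewrite [LHS](AC (2*2) ((3*1)*(2*4))).
- by rewrite [LHS](AC (2*2) ((4*2)*(1*3))).
- by rewrite [LHS](AC (2*2) ((2*4)*(3*1))).
Qed.

End RealForm.

(** * The real form of a tensor product of matrices *)

Section Pure.
Context {F : fieldType}.
Variables V W : lmodType F.

Lemma pureNl (v : V) (w : W) : pure (- v) w = - pure v w.
Proof. by rewrite -scaleN1r pureZl scaleN1r. Qed.

Lemma pureNr (v : V) (w : W) : pure v (- w) = - pure v w.
Proof. by rewrite -scaleN1r pureZr scaleN1r. Qed.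

Lemma pure0l (w : W) : pure (0 : V) w = 0.
Proof. by rewrite -(scale0r (0 : V)) pureZl scale0r. Qed.

Lemma pure0r (v : V) : pure v (0 : W) = 0.
Proof. by rewrite -(scale0r (0 : W)) pureZr scale0r. Qed.

End Pure.

Lemma kronE (F : numFieldType) (theta : {rmorphism F -> F})
    (V W : mosystem theta) p q (A : 'M[V]_p) (B : 'M[W]_q) i j :
  kron A B (mxtens_index i) (mxtens_index j)
  = pure (A i.1 j.1) (B i.2 j.2).
Proof. by rewrite mxE !mxtens_indexK. Qed.

Section RealFormKron.
Variable R : realType.
Local Notation C := R[i].

Lemma sqrt_half : Num.sqrt (2^-1 : R) * Num.sqrt 2^-1 = 2^-1.
Proof. by rewrite -expr2 sqr_sqrtr // invr_ge0. Qed.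

Lemma half_add (V : lmodType R) (x : V) : x = 2^-1 *: x + 2^-1 *: x.
Proof. by rewrite -scalerDl -[2^-1]mul1r -splitr scale1r. Qed.

Variables V W : mosystem (idfun : {rmorphism R -> R}).

(** The complex-bilinear extension of [pure]: (v + iv') (x) (w + iw') multiplied out. *)
Definition cpure (v : complexify V) (w : complexify W) :
    complexify (tensor V W) :=
  (pure v.1 w.1 - pure v.2 w.2, pure v.1 w.2 + pure v.2 w.1).

Definition ckron p q (A : 'M[complexify V]_p) (B : 'M[complexify W]_q) :
    'M[complexify (tensor V W)]_(p * q) :=
  \matrix_(i, j) cpure (A (mxtens_unindex i).1 (mxtens_unindex j).1)
                       (B (mxtens_unindex i).2 (mxtens_unindex j).2).

(** [twist_fst] and [twist_snd] give the two rows supporting a column of [twist]: e0 (x) e0 and e1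
    (x) e1 in the first half, e0 (x) e1 and e1 (x) e0 in the second. *)
Definition twist_fst p q (i : 'I_(p * q + p * q)) : 'I_((p + p) * (q + q)) :=
  match split i with
  | inl z => let u := mxtens_unindex z in
             mxtens_index (lshift p u.1, lshift q u.2)
  | inr z => let u := mxtens_unindex z in
             mxtens_index (lshift p u.1, rshift q u.2)
  end.

Definition twist_snd p q (i : 'I_(p * q + p * q)) : 'I_((p + p) * (q + q)) :=
  match split i with
  | inl z => let u := mxtens_unindex z in
             mxtens_index (rshift p u.1, rshift q u.2)
  | inr z => let u := mxtens_unindex z in
             mxtens_index (rshift p u.1, lshift q u.2)
  end.

(* The isometry onto the plane J (x) 1 = 1 (x) J, spanned by                  *)
(* (e0 (x) e0 - e1 (x) e1)/sqrt 2 and (e0 (x) e1 + e1 (x) e0)/sqrt 2.         *)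
Definition twist p q : 'M[R]_((p + p) * (q + q), p * q + p * q) :=
  let r := Num.sqrt 2^-1 in
  \matrix_(k, i) (r *+ (k == twist_fst i)
    + (if split i is inl _ then - r else r) *+ (k == twist_snd i)).

(** The real forms are a (x) 1 + a' (x) J and b (x) 1 + b' (x) J. On the range of [twist] both J (x)
    1 and 1 (x) J act as one rotation J, and J (x) J acts as -1, which leaves (a (x) b - a' (x) b')
    + (a (x) b' + a' (x) b) J. *)
Lemma cblock_kron p q (A : 'M[complexify V]_p) (B : 'M[complexify W]_q) :
  cblock (ckron A B)
  = mxcompress (theta := idfun) (twist p q) (kron (cblock A) (cblock B)).
Proof.
rewrite /twist mxcompress_pair; apply/matrixP => i j; rewrite [RHS]mxE.
rewrite /twist_fst /twist_snd.
case: (split_ordP i) => i' ->; case: (split_ordP j) => j' ->;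
  rewrite !cblockE !kronE !cblockE [ckron _ _ _ _]mxE;
  rewrite ?(mulrN, mulNr, opprK) !sqrt_half ?(pureNl, pureNr, opprK);
  rewrite ?(scaleNr, scalerN, opprK) ?opprD;
  (* Of the four terms, the first agrees with the fourth and the second with the third, each with
     weight 1/2. *)
  by rewrite -?scalerN [RHS](AC (2*2) ((1*4)*(2*3))) /= -!half_add.
Qed.

End RealFormKron.

(** * The canonical isomorphism and its inverse *)

Section Canonical.
Local Open Scope complex_scope.
Variable R : realType.
Local Notation C := R[i].
Variables V W : mosystem (idfun : {rmorphism R -> R}).
Local Notation Vc := (complexification V).
Local Notation Wc := (complexification W).
Local Notation T := (tensor V W).
Local Notation Tc := (tensor Vc Wc).

Lemma cembedD (X : lmodType R) : {morph @cembed R X : x y / x + y}.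
Proof. by move=> x y; congr (_, _); rewrite addr0. Qed.

Lemma cembedZ (X : lmodType R) (a : R) (x : X) :
  cembed (a *: x) = a%:C *: cembed x.
Proof. by rewrite complexifyZ !scaler0 scale0r subr0 addr0. Qed.

Lemma complexify_eta (X : lmodType R) (x : complexify X) :
  x = cembed x.1 + 'i *: cembed x.2.
Proof.
case: x => x y; rewrite complexifyZ !scale0r !scaler0 scale1r subr0 add0r.
by congr (_, _); rewrite /= ?addr0 ?add0r.
Qed.

Definition tembed : T -> Tc :=
  tlift (fun v w => pure (cembed v : Vc) (cembed w : Wc)).

Let tembed_Dl (v v' : V) (w : W) :
  pure (cembed (v + v') : Vc) (cembed w : Wc)
  = pure (cembed v : Vc) (cembed w : Wc)
    + pure (cembed v' : Vc) (cembed w : Wc).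
Proof. by rewrite cembedD pureDl. Qed.

Let tembed_Dr (v : V) (w w' : W) :
  pure (cembed v : Vc) (cembed (w + w') : Wc)
  = pure (cembed v : Vc) (cembed w : Wc)
    + pure (cembed v : Vc) (cembed w' : Wc).
Proof. by rewrite cembedD pureDr. Qed.

Let tembed_Z (a : R) (v : V) (w : W) :
  pure (cembed (a *: v) : Vc) (cembed w : Wc)
  = pure (cembed v : Vc) (cembed (a *: w) : Wc).
Proof. by rewrite !cembedZ pure_balanced. Qed.

Lemma tembed_pure v w :
  tembed (pure v w) = pure (cembed v : Vc) (cembed w : Wc).
Proof. exact: tlift_pure. Qed.

Lemma tembedD : {morph tembed : x y / x + y}.
Proof. exact: tliftD. Qed.

Lemma tembedZ (a : R) x : tembed (a *: x) = a%:C *: tembed x.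
Proof.
apply: (@tlift_unique _ _ _ _ (fun x => tembed (a *: x))
  (fun x => a%:C *: tembed x)) => [u v|u v|v w].
- by rewrite scalerDr tembedD.
- by rewrite tembedD scalerDr.
- by rewrite -pureZl !tembed_pure cembedZ pureZl.
Qed.

Lemma tembed0 : tembed 0 = 0.
Proof. by apply: (addrI (tembed 0)); rewrite -tembedD !addr0. Qed.

Lemma tembedN x : tembed (- x) = - tembed x.
Proof. by apply: (addrI (tembed x)); rewrite -tembedD !subrr tembed0. Qed.

Lemma tembed_star x : tembed (tstar x) = tstar (tembed x).
Proof.
apply: (@tlift_unique _ _ _ _ (fun x => tembed (tstar x))
  (fun x => tstar (tembed x))) => [u v|u v|v w].
- by rewrite tstarD tembedD.
- by rewrite tembedD tstarD.
rewrite tstar_pure !tembed_pure tstar_pure.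
by congr pure; congr (_, _); rewrite /= star0 oppr0.
Qed.

Definition canon (x : complexify T) : Tc := tembed x.1 + 'i *: tembed x.2.

Lemma canon_linear : linear canon.
Proof.
case=> a b [x y] [x' y']; rewrite complexifyZ /canon /=.
rewrite !tembedD tembedN !tembedZ !scalerDr -!complexiE.
have -> : a +i* b = a%:C + 'i * b%:C by rewrite [LHS]complexE.
rewrite !scalerDl -!scalerA.
have comm z (t : Tc) : 'i *: (z *: t) = z *: ('i *: t).
  by rewrite !scalerA mulrC.
have ii (z : Tc) : 'i *: ('i *: z) = - z.
  by rewrite scalerA -expr2 sqr_i scaleN1r.
rewrite !(comm b%:C) !(comm a%:C) ii scalerN.
by rewrite [LHS](AC (3*3) ((1*5)*(4*2)*(3*6))).
Qed.

Definition uncanon : Tc -> complexify T := tlift (@cpure R V W).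

Let cpure_Dl v v' w : cpure (v + v') w = cpure v w + cpure v' w :> complexify T.
Proof.
by congr (_, _) => /=; rewrite !pureDl ?opprD addrACA.
Qed.

Let cpure_Dr v w w' : cpure v (w + w') = cpure v w + cpure v w' :> complexify T.
Proof.
by congr (_, _) => /=; rewrite !pureDr ?opprD addrACA.
Qed.

Lemma cpureZl (a : C) v w : cpure (a *: v) w = a *: cpure v w :> complexify T.
Proof.
case: a v w => a b [v v'] [w w']; rewrite /cpure !complexifyZ /=.
rewrite !pureDl !pureNl !pureZl !scalerBr !scalerDr !opprD.
by congr (_, _); rewrite [LHS](AC (2*2) ((1*3)*(4*2))).
Qed.

Lemma cpureZr (a : C) v w : cpure v (a *: w) = a *: cpure v w :> complexify T.
Proof.
case: a v w => a b [v v'] [w w']; rewrite /cpure !complexifyZ /=.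
rewrite !pureDr !pureNr !pureZr !scalerBr !scalerDr !opprD ?opprK.
by congr (_, _); rewrite [LHS](AC (2*2) ((1*3)*(2*4))).
Qed.

Let cpure_Z (a : C) v w : cpure (a *: v) w = cpure v (a *: w) :> complexify T.
Proof. by rewrite cpureZl cpureZr. Qed.

Lemma uncanon_pure v w : uncanon (pure v w) = cpure v w.
Proof. exact: tlift_pure. Qed.

Lemma uncanonD : {morph uncanon : x y / x + y}.
Proof. exact: tliftD. Qed.

Lemma uncanon0 : uncanon 0 = 0.
Proof. by apply: (addrI (uncanon 0)); rewrite -uncanonD !addr0. Qed.

Lemma uncanonZ (a : C) x : uncanon (a *: x) = a *: uncanon x.
Proof.
apply: (@tlift_unique _ _ _ _ (fun x => uncanon (a *: x))
  (fun x => a *: uncanon x)) => [u v|u v|v w].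
- by rewrite scalerDr uncanonD.
- by rewrite uncanonD scalerDr.
- by rewrite -pureZl !uncanon_pure cpureZl.
Qed.

Lemma canonD : {morph canon : x y / x + y}.
Proof. by move=> x y; have := canon_linear 1 x y; rewrite !scale1r. Qed.

Lemma canon_cembed_pure v w :
  canon (cembed (pure v w)) = pure (cembed v : Vc) (cembed w : Wc).
Proof. by rewrite /canon tembed0 scaler0 addr0 tembed_pure. Qed.

Lemma tembedK x : uncanon (tembed x) = cembed x.
Proof.
apply: (@tlift_unique _ _ _ _ (fun x => uncanon (tembed x))
  (fun x => cembed x)) => [u v|u v|v w].
- by rewrite tembedD uncanonD.
- by rewrite cembedD.
by rewrite tembed_pure uncanon_pure; congr (_, _);
  rewrite /= ?pure0l ?pure0r ?subr0 ?addr0.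
Qed.

Lemma canonK : cancel canon uncanon.
Proof.
by move=> x; rewrite uncanonD uncanonZ !tembedK -complexify_eta.
Qed.

Lemma uncanonK : cancel uncanon canon.
Proof.
apply: (@tlift_unique _ _ _ _ (fun x => canon (uncanon x)) id) => //.
  by move=> u v; rewrite uncanonD canonD.
move=> v w; rewrite uncanon_pure /canon /cpure /=.
rewrite !tembedD tembedN !tembed_pure.
(* The fifth occurrences are those in [pure v w] on the right-hand side. *)
rewrite {5}[v]complexify_eta {5}[w]complexify_eta.
rewrite !pureDl !pureDr !pureZl !pureZr scalerA -expr2 sqr_i scaleN1r scalerDr.
by rewrite [LHS](AC (2*2) ((1*3)*(4*2))).
Qed.

Lemma canon_star (x : complexify T) :
  canon (@cstar R (max_tensor V W) x) = tstar (canon x).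
Proof.
rewrite /canon /= tstarD tstarZ !tembedN !tembed_star scalerN -scaleNr.
by congr (_ + _ *: _); congr (_ +i* _); rewrite ?oppr0.
Qed.

End Canonical.

(** * Transport of decompositions and comparison of the cones *)

Section MaxSum.
Local Open Scope complex_scope.
Variable R : realType.
Local Notation C := R[i].

(** In a representation on H, the quadratic form of [A 0; 0 A] at a vector of 2n entries is the sum
    of the values of the form of A at its two halves. *)
Lemma cone_cembed (V : mosystem (idfun : {rmorphism R -> R})) n (A : 'M[V]_n) :
  operator_system V -> cone A ->
  cone (map_mx (@cembed R V) A : 'M[complexification V]_n).
Proof.
move=> [H [phi rep]] /(rep_cone rep) [As Apos].
have fstA : map_mx fst (map_mx (@cembed R V) A) = A.
  by apply/matrixP => i j; rewrite !mxE.
have sndA : map_mx snd (map_mx (@cembed R V) A) = 0.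
  by apply/matrixP => i j; rewrite !mxE.
have mxstar0 m : mxstar (0 : 'M[V]_m) = 0.
  by apply/matrixP => i j; rewrite !mxE star0.
have phi0 h : phi 0 h = 0.
  have := rep_linear rep 1 0 0 h.
  by rewrite !scale1r addr0 => e; apply: (addrI (phi 0 h)); rewrite -e addr0.
rewrite /= /ccone fstA sndA mxstar0 oppr0 As; split=> //.
apply/(rep_cone rep); split.
  rewrite -[RHS]/(block_mx A 0 0 A) -[in RHS]As.
  rewrite /mxstar tr_block_mx map_block_mx.
  by congr block_mx; exact: mxstar0.
move=> h; rewrite big_split_ord /= addr_ge0 //.
  (* The remaining inequality is an equality, since the off-diagonal zero blocks contribute
     nothing. *)
  apply: le_trans (Apos (fun i => h (lshift n i))) _.
  rewrite le_eqVlt; apply/orP; left; apply/eqP; apply: eq_bigr => i _.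
  rewrite big_split_ord /= [X in _ + X]big1 ?addr0 => [|j _].
    by apply: eq_bigr => j _; rewrite block_mxEul.
  by rewrite block_mxEur mxE phi0 linear0l.
apply: le_trans (Apos (fun i => h (rshift n i))) _.
rewrite le_eqVlt; apply/orP; left; apply/eqP; apply: eq_bigr => i _.
rewrite big_split_ord /= [X in X + _]big1 ?add0r => [|j _].
  by apply: eq_bigr => j _; rewrite block_mxEdr.
by rewrite block_mxEdl mxE phi0 linear0l.
Qed.

Variables V W : mosystem (idfun : {rmorphism R -> R}).
Local Notation Vc := (complexification V).
Local Notation Wc := (complexification W).
Local Notation T := (tensor V W).
Local Notation Tc := (tensor Vc Wc).
Local Notation tembed := (@tembed R V W).
Local Notation canon := (@canon R V W).
Local Notation uncanon := (@uncanon R V W).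

Lemma tembed_compress m n (alpha : 'M[R]_(m, n)) (X : 'M[T]_m) :
  map_mx tembed (mxcompress (theta := idfun) alpha X)
  = mxcompress (theta := conjc) (map_mx (real_complex R) alpha)
      (map_mx tembed X).
Proof.
have tembed_sum := big_morph tembed (@tembedD R V W) (@tembed0 R V W).
apply/matrixP => i j; rewrite !mxE tembed_sum; apply: eq_bigr => k _.
rewrite tembed_sum; apply: eq_bigr => l _.
rewrite tembedZ rmorphM !mxE; congr (_ * _ *: _).
exact/esym/conjc_real.
Qed.

Lemma tembed_kron p q (A : 'M[V]_p) (B : 'M[W]_q) :
  map_mx tembed (kron A B)
  = kron (map_mx (@cembed R V) A : 'M[Vc]_p)
      (map_mx (@cembed R W) B : 'M[Wc]_q).
Proof. by apply/matrixP => i j; rewrite !mxE tembed_pure. Qed.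

(** The column (1; -i)/sqrt 2 is a unit eigenvector of J for the eigenvalue i, so compressing x (x)
    1 + y (x) J by it yields x + iy. *)
Definition fold_mx n : 'M[C]_(n + n, n) :=
  let r := (Num.sqrt 2^-1)%:C in
  \matrix_(k, i) (r *+ (k == lshift n i) + (- 'i * r) *+ (k == rshift n i)).

Lemma canon_fold_mx n (Z : 'M[complexify T]_n) :
  map_mx canon Z
  = mxcompress (theta := conjc) (fold_mx n) (map_mx tembed (cblock Z)).
Proof.
pose r : C := (Num.sqrt (2^-1 : R))%:C; pose h : C := (2^-1 : R)%:C.
have rr : r * r = h by rewrite -rmorphM sqrt_half.
have cr : conjc r = r by exact: conjc_real.
have cir : conjc (- 'i * r) = 'i * r.
  transitivity (conjc (- 'i) * conjc r); first exact: rmorphM.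
  rewrite cr; congr (_ * _); apply/eqP.
  by rewrite eq_complex /= oppr0 opprK !eqxx.
rewrite /fold_mx -/r mxcompress_pair; apply/matrixP => i j.
rewrite [LHS]mxE [RHS]mxE ![map_mx _ _ _ _]mxE !cblockE.
(* The blocks x, -y, y, x receive the weights 1/2, -i/2, i/2, 1/2. *)
transitivity (h *: tembed (Z i j).1 + (- 'i * h) *: tembed (- (Z i j).2)
  + (('i * h) *: tembed (Z i j).2 + h *: tembed (Z i j).1)); last first.
  congr (_ *: _ + _ *: _ + (_ *: _ + _ *: _)).
  - by rewrite -[RHS]/(conjc r * r) cr rr.
  - by rewrite -[RHS]/(conjc r * (- 'i * r)) cr mulrCA rr.
  - by rewrite -[RHS]/(conjc (- 'i * r) * r) cir -mulrA rr.
  - rewrite -[RHS]/(conjc (- 'i * r) * (- 'i * r)) cir mulrACA rr.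
    by rewrite mulrN -expr2 sqr_i opprK mul1r.
have hh : h + h = 1 by rewrite -rmorphD -[2^-1]mul1r -splitr.
rewrite tembedN mulNr scaleNr scalerN opprK [RHS](AC (2*2) ((1*4)*(2*3))) /=.
by rewrite -!scalerDl -mulrDr hh scale1r mulr1.
Qed.

Lemma max_sum_canon n (Z : 'M[complexify T]_n) :
  operator_system V -> operator_system W ->
  max_sum (cblock Z) -> max_sum (map_mx canon Z).
Proof.
move=> osV osW [k [p [q [A [B [alpha [cA cB E]]]]]]].
exists k, p, q, (fun i => map_mx (@cembed R V) (A i)).
exists (fun i => map_mx (@cembed R W) (B i)).
exists (fun i => map_mx (real_complex R) (alpha i) *m fold_mx n).
split=> [i|i|]; [exact: cone_cembed|exact: cone_cembed|].
have -> : map_mx canon Z = mxcompress (theta := conjc) (fold_mx n)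
    (\sum_i map_mx tembed
       (mxcompress (theta := idfun) (alpha i) (kron (A i) (B i)))).
  rewrite canon_fold_mx E; congr mxcompress; apply/matrixP => i j.
  rewrite mxE !summxE (big_morph tembed (@tembedD R V W) (@tembed0 R V W)).
  by apply: eq_bigr => l _; rewrite [RHS]mxE.
rewrite mxcompress_sum; apply: eq_bigr => i _.
by rewrite tembed_compress tembed_kron mxcompress_comp.
Qed.

Lemma uncanon_kron p q (A : 'M[Vc]_p) (B : 'M[Wc]_q) :
  map_mx uncanon (kron A B) = ckron A B.
Proof. by apply/matrixP => i j; rewrite !mxE uncanon_pure. Qed.

Lemma uncanon_compress m n (alpha : 'M[C]_(m, n)) (X : 'M[Tc]_m) :
  map_mx uncanon (mxcompress (theta := conjc) alpha X)
  = mxcompress (theta := conjc) alpha (map_mx uncanon X).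
Proof.
have uncanon_sum := big_morph uncanon (@uncanonD R V W) (@uncanon0 R V W).
apply/matrixP => i j; rewrite !mxE uncanon_sum; apply: eq_bigr => k _.
rewrite uncanon_sum; apply: eq_bigr => l _.
by rewrite uncanonZ !mxE.
Qed.

Lemma max_sum_cblock n (Z : 'M[complexify T]_n) :
  max_sum (map_mx canon Z) -> max_sum (cblock Z).
Proof.
move=> [k [p [q [A [B [alpha [cA cB E]]]]]]].
exists k, (fun i => p i + p i)%N, (fun i => q i + q i)%N.
exists (fun i => cblock (A i)), (fun i => cblock (B i)).
exists (fun i => twist R (p i) (q i) *m rblock (alpha i)).
(* Positivity of [A i] over C contains positivity of its real form. *)
split=> [i|i|]; first by case: (cA i).
  by case: (cB i).
have -> : Z = \sum_i mxcompress (theta := conjc) (alpha i) (ckron (A i) (B i)).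
  have : Z = map_mx uncanon (map_mx canon Z).
    by apply/matrixP => i j; rewrite !mxE canonK.
  rewrite E => ->; apply/matrixP => i j.
  rewrite mxE !summxE (big_morph uncanon (@uncanonD R V W) (@uncanon0 R V W)).
  apply: eq_bigr => l _; rewrite -uncanon_kron -uncanon_compress.
  by rewrite [RHS]mxE.
rewrite cblock_sum; apply: eq_bigr => i _.
by rewrite cblock_compress cblock_kron mxcompress_comp.
Qed.

(** The unit has no imaginary part, so its real form is diagonal with the same eps; no rescaling
    arises in either direction. *)
Lemma cblock_unit n (X : 'M[complexify T]_n) (eps : R) :
  cblock (X + (eps%:C *: cembed (pure (mounit V) (mounit W)))%:M)
  = cblock X + (eps *: pure (mounit V) (mounit W))%:M.
Proof.
rewrite cblockD scalar_mx_block; congr (_ + _).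
rewrite -cembedZ /cblock; congr block_mx; apply/matrixP => i j;
  by rewrite !mxE; case: (i == j); rewrite ?mulr1n ?mulr0n /= ?oppr0.
Qed.

Lemma canon_unit n (X : 'M[complexify T]_n) (eps : C) :
  map_mx canon (X + (eps *: cembed (pure (mounit V) (mounit W)))%:M)
  = map_mx canon X
    + (eps *: pure (cembed (mounit V) : Vc) (cembed (mounit W) : Wc))%:M.
Proof.
have canon0 : canon 0 = 0 by apply: (addrI (canon 0)); rewrite -canonD !addr0.
have canonZ a x : canon (a *: x) = a *: canon x.
  by have := canon_linear a x 0; rewrite canon0 !addr0.
apply/matrixP => i j; rewrite !mxE canonD; congr (_ + _).
by case: (i == j); rewrite ?mulr0n // !mulr1n canonZ canon_cembed_pure.
Qed.

Lemma cblock_star n (X : 'M[complexify T]_n) :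
  map_mx (@cstar R (max_tensor V W)) X^T = X <->
  map_mx (@tstar _ _ V W) (cblock X)^T = cblock X.
Proof.
have tstarN x : tstar (- x) = - tstar x :> T.
  by rewrite -scaleN1r tstarZ rmorphN1 scaleN1r.
split=> E.
  rewrite -[in RHS]E; apply/matrixP => i j; rewrite [LHS]mxE [X in tstar X]mxE.
  by case: (split_ordP i) => i' ->; case: (split_ordP j) => j' ->;
    rewrite !cblockE !mxE /= ?tstarN ?opprK.
apply/matrixP => i j; rewrite !mxE.
(* The left column of blocks consists of x and y, which determine X. *)
have e1 := congr1 (fun M : 'M_(n + n) => M (lshift n i) (lshift n j)) E.
have e2 := congr1 (fun M : 'M_(n + n) => M (rshift n i) (lshift n j)) E.
move: e1 e2; rewrite /= ![map_mx _ _ _ _]mxE ![_^T _ _]mxE !cblockE tstarN.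
move=> e1 e2.
by case: (X i j) e1 e2 => x y /= <- <-.
Qed.

Lemma canon_cone n (X : 'M[complexify T]_n) :
  operator_system V -> operator_system W ->
  (cone (X : 'M[complexification (max_tensor V W)]_n) <->
   max_cone (map_mx canon X : 'M[tensor Vc Wc]_n)).
Proof.
move=> osV osW.
have canon_starM : map_mx (@tstar _ _ Vc Wc) (map_mx canon X)^T = map_mx canon X
    <-> map_mx (@cstar R (max_tensor V W)) X^T = X.
  split=> E.
    apply/matrixP => i j; apply: (can_inj (@canonK R V W)).
    have := congr1 (fun M : 'M_n => M i j) E; rewrite !mxE => <-.
    exact: canon_star.
  rewrite -[in RHS]E; apply/matrixP => i j; rewrite !mxE.
  by apply/esym/canon_star.
split.
  move=> [_ _ /max_coneP [Xs Xp]]; apply/max_coneP; split.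
    exact/canon_starM/cblock_star.
  (* A positive complex eps has zero imaginary part, so it is a positive real and the real
     hypothesis applies to it. *)
  case=> a b; rewrite ltcE /= => /andP[/eqP -> a0].
  rewrite -canon_unit; apply: max_sum_canon => //.
  by rewrite cblock_unit; exact: Xp.
move=> /max_coneP [Xs Xp].
have Xc := canon_starM.1 Xs.
have Xe i j : @cstar R (max_tensor V W) (X j i) = X i j.
  by rewrite -[in RHS]Xc !mxE.
split.
- by apply/matrixP => i j; rewrite !mxE -Xe.
- by apply/matrixP => i j; rewrite !mxE -Xe.
apply/max_coneP; split; first exact/cblock_star.
move=> eps eps0; rewrite -cblock_unit; apply: max_sum_cblock.
by rewrite canon_unit; apply: Xp; rewrite ltcR.
Qed.

End MaxSum.

Theorem theorem10p9 (R : realType)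
    (V W : mosystem (idfun : {rmorphism R -> R})) :
  operator_system V -> operator_system W ->
  exists f : complexification (max_tensor V W) ->
             max_tensor (complexification V) (complexification W),
    (forall (v : V) (w : W),
       f (cembed (pure v w)) = pure (cembed v) (cembed w)) /\
    unital_complete_order_iso f.
Proof.
move=> osV osW; exists (@canon R V W); split; first exact: canon_cembed_pure.
split.
- exact: canon_linear.
- by exists (@uncanon R V W); [exact: canonK|exact: uncanonK].
- exact: canon_cembed_pure.
- exact: canon_star.
- by move=> n X; apply: canon_cone.
Qed.
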